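(* Let $\mathcal P=\langle\mathcal S,\mathcal W,\mathcal Q,\mathcal T\rangle$ be a complexity problem, $f:\mathbb N\to\mathbb N$, and let $(\succsim,\succ)$ be a $\mathcal P$-monotone complexity pair such that $\succ$ induces the complexity $f$ on $\mathcal P$. If $\mathcal S\subseteq{\succ}$ and $\mathcal W\subseteq{\succsim}$, then the judgement $\mathcal P\vdash f$ is valid, i.e. $\mathrm{cc}_{\mathcal P}$ is defined on all inputs and $\mathrm{cc}_{\mathcal P}\in O(f)$.
   Context: Terms are built from a signature $\mathcal F$ and a countably infinite set of variables $\mathcal V$; $|t|$ is the number of symbol occurrences in $t$. For TRSs $\mathcal Q,\mathcal R$ write $s\to^{\mathcal Q}_{\mathcal R}t$ iff there are a context $C$, a substitution $\sigma$ and a rule $f(l_1,\dots,l_n)\to r\in\mathcal R$ with $s=C[f(l_1\sigma,\dots,l_n\sigma)]$, $t=C[r\sigma]$, and every $l_i\sigma$ is a normal form of $\mathcal Q$. ${\to^{\mathcal Q}_{\mathcal S/\mathcal W}}=(\to^{\mathcal Q}_{\mathcal W})^*\cdot\to^{\mathcal Q}_{\mathcal S}\cdot(\to^{\mathcal Q}_{\mathcal W})^*$. $\mathrm{dh}(t,\to)=\max\{n\mid\exists t_1,\dots,t_n.\ t\to t_1\to\cdots\to t_n\}$ (partial). A complexity problem $\mathcal P=\langle\mathcal S,\mathcal W,\mathcal Q,\mathcal T\rangle$ consists of TRSs $\mathcal S,\mathcal W,\mathcal Q$ and a set of terms $\mathcal T$; its complexity function is the partial function $\mathrm{cc}_{\mathcal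 P}(n)=\max\{\mathrm{dh}(t,\to^{\mathcal Q}_{\mathcal S/\mathcal W})\mid t\in\mathcal T,|t|\le n\}$; $\to_{\mathcal P}=\to^{\mathcal Q}_{\mathcal S\cup\mathcal W}$ and $\to_{\mathcal P}^*(\mathcal T)$ is the set of terms reachable from $\mathcal T$. Replacement maps: $\mu(f)\subseteq\{1,\dots,\mathrm{arity}(f)\}$; $\mathrm{Pos}_\mu(x)=\{\varepsilon\}$, $\mathrm{Pos}_\mu(f(t_1,\dots,t_n))=\{\varepsilon\}\cup\{i\cdot p\mid i\in\mu(f),p\in\mathrm{Pos}_\mu(t_i)\}$; $\mathcal T_\mu(\to)$ is the set of terms $s$ all of whose positions $p$ with $s|_p$ not a $\to$-normal form lie in $\mathrm{Pos}_\mu(s)$; $\mu$ is a usable replacement map for $\mathcal R$ in $\mathcal P$ if $\to_{\mathcal P}^*(\mathcal T)\subseteq\mathcal T_\mu(\to^{\mathcal Q}_{\mathcal R})$. A relation $R$ is $\mu$-monotone if $i\in\mu(f)$, $s_i\mathrel R t_i$ imply $f(\dots,s_i,\dots)\mathrel R f(\dots,t_i,\dots)$. A complexity pair $(\succsim,\succ)$: $\succsim$ a preorder, $\succ$ an order, both stable under substitutions, ${\succsim}\cdot{\succ}\cdot{\succsim}\subseteq{\succ}$. It is $\mathcal P$-monotone if $\succsim$ is $\mu_{\mathcal W}$-monotone and $\succ$ is $\mu_{\mathcal S}$-monotone for usable replacement maps $\mu_{\mathcal W}$ of $\mathcal W$ and $\mu_{\mathcal S}$ of $\mathcal S$ in $\mathcal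 P$. $\succ$ is $G$-collapsible on $\mathcal P$ (for $G$ mapping terms to $\mathbb N$) if for all $s\in\to_{\mathcal P}^*(\mathcal T)$, $s\to^{\mathcal Q}_{\mathcal S/\mathcal W}t$ and $s\succ t$ imply $G(s)>G(t)$; $\succ$ induces the complexity $f$ on $\mathcal P$ if it is $G$-collapsible on $\mathcal P$ for some $G$ with $G(t)\in O(f(|t|))$ for $t\in\mathcal T$. $\mathcal R\subseteq{\succ}$ means $l\succ r$ for all $l\to r\in\mathcal R$.
   Formalization: ''G(t) ∈ O(f(|t|)) for t ∈ T'' is taken as: the function n ↦ max{G(t) | t ∈ T, |t| ≤ n} is in O(f), because with the termwise bound the claim fails for non-monotone f. *)

(* Defs.v *)
From mathcomp Require Import all_boot.
From Stdlib Require Import Relations RelationClasses Classical.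

Set Implicit Arguments.
Unset Strict Implicit.
Unset Printing Implicit Defensive.

Record signature := Signature {
  symbol :> Type;
  arity : symbol -> nat
}.

(* The countably infinite set of variables is nat; arguments are indexed from
   0. *)
Inductive term (F : signature) : Type :=
| Var (x : nat)
| Fun (f : F) (ts : {ffun 'I_(arity f) -> term F}).

Arguments Var {F} x.
Arguments Fun {F} f ts.

Fixpoint tsize (F : signature) (t : term F) : nat :=
  match t with
  | Var _ => 1
  | Fun f ts => (\sum_(i < arity f) tsize (ts i)).+1
  end.

Definition substitution (F : signature) := nat -> term F.

Fixpoint subst (F : signature) (sigma : substitution F) (t : term F) : term F :=
  match t with
  | Var x => sigma x
  | Fun f ts => Fun f [ffun i => subst sigma (ts i)]
  end.

Definition set_arg (F : signature) (f : F) (ts : {ffun 'I_(arity f) -> term F})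
    (i : 'I_(arity f)) (t : term F) : {ffun 'I_(arity f) -> term F} :=
  [ffun j => if j == i then t else ts j].

(* One-hole contexts: in [CFun f ts i C] the i-th argument is the context C and
   the value ts i is ignored. *)
Inductive context (F : signature) : Type :=
| Hole
| CFun (f : F) (ts : {ffun 'I_(arity f) -> term F}) (i : 'I_(arity f))
    (C : context F).

Fixpoint fill (F : signature) (C : context F) (t : term F) : term F :=
  match C with
  | Hole => t
  | CFun f ts i C' => Fun f (set_arg ts i (fill C' t))
  end.

(* subterm_at s p u : p is a position of s and u is the subterm of s at p. *)
Inductive subterm_at (F : signature) : term F -> seq nat -> term F -> Prop :=
| subterm_at_root s : subterm_at s [::] s
| subterm_at_arg (f : F) (ts : {ffun 'I_(arity f) -> term F}) (i : 'I_(arity f))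
    p u :
    subterm_at (ts i) p u -> subterm_at (Fun f ts) (val i :: p) u.

Definition occurs (F : signature) (x : nat) (t : term F) : Prop :=
  exists p, subterm_at t p (Var x).

Record trs (F : signature) := Trs {
  rules :> relation (term F);
  trs_lhs : forall l r, rules l r -> exists f ls, l = Fun f ls;
  trs_vars : forall l r x, rules l r -> occurs x r -> occurs x l
}.

Definition normal_form (F : signature) (rel : relation (term F)) (s : term F) :
    Prop :=
  ~ exists t, rel s t.

Definition rewrite_step (F : signature) (R : relation (term F)) :
    relation (term F) := fun s t =>
  exists (C : context F) (sigma : substitution F) (l r : term F),
    [/\ R l r, s = fill C (subst sigma l) & t = fill C (subst sigma r)].

Definition qstep (F : signature) (Q R : relation (term F)) :
    relation (term F) := fun s t =>
  exists (C : context F) (sigma : substitution F) (f : F)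
         (ls : {ffun 'I_(arity f) -> term F}) (r : term F),
    [/\ R (Fun f ls) r,
        s = fill C (Fun f [ffun i => subst sigma (ls i)]),
        t = fill C (subst sigma r) &
        forall i, normal_form (rewrite_step Q) (subst sigma (ls i))].

Definition qstep_rel (F : signature) (Q S W : relation (term F)) :
    relation (term F) := fun s t =>
  exists s' t', [/\ clos_refl_trans _ (qstep Q W) s s',
                    qstep Q S s' t' &
                    clos_refl_trans _ (qstep Q W) t' t].

(* Partial functions to nat are represented by their graphs. The maximum of
   the empty set is 0 (no term has size at most 0); the maximum of an unbounded
   set is undefined. *)
Definition is_max (A : nat -> Prop) (m : nat) : Prop :=
  (A m \/ m = 0 /\ forall k, ~ A k) /\ forall k, A k -> k <= m.

Definition derivation (F : signature) (rel : relation (term F)) (t : term F)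
    (n : nat) : Prop :=
  exists u : nat -> term F, u 0 = t /\ forall i, i < n -> rel (u i) (u i.+1).

Definition dh (F : signature) (rel : relation (term F)) (t : term F) :
    nat -> Prop :=
  is_max (derivation rel t).

(* max { g(t) | t in T, |t| <= n }, undefined as soon as one of the g(t) is. *)
Definition worst_case (F : signature) (T : term F -> Prop)
    (g : term F -> nat -> Prop) (n m : nat) : Prop :=
  (forall t, T t -> tsize t <= n -> exists k, g t k) /\
  is_max (fun k => exists t, [/\ T t, tsize t <= n & g t k]) m.

Definition bigO (g : nat -> nat -> Prop) (f : nat -> nat) : Prop :=
  exists c N, forall n, N <= n -> exists m, g n m /\ m <= c * f n.

Record problem (F : signature) := Problem {
  strict : trs F;
  weak : trs F;
  query : trs F;
  start : term F -> Prop
}.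

Definition problem_step (F : signature) (P : problem F) : relation (term F) :=
  qstep (query P) (union _ (strict P) (weak P)).

Definition problem_rel (F : signature) (P : problem F) : relation (term F) :=
  qstep_rel (query P) (strict P) (weak P).

Definition reachable (F : signature) (P : problem F) (s : term F) : Prop :=
  exists t, start P t /\ clos_refl_trans _ (problem_step P) t s.

Definition cc (F : signature) (P : problem F) : nat -> nat -> Prop :=
  worst_case (start P) (dh (problem_rel P)).

Definition valid_judgement (F : signature) (P : problem F) (f : nat -> nat) :
    Prop :=
  (forall n, exists m, cc P n m) /\ bigO (cc P) f.

Definition replacement_map (F : signature) := forall f : F, {set 'I_(arity f)}.

Inductive mu_pos (F : signature) (mu : replacement_map F) :
    term F -> seq nat -> Prop :=
| mu_pos_root s : mu_pos mu s [::]
| mu_pos_arg (f : F) (ts : {ffun 'I_(arity f) -> term F}) (i : 'I_(arity f)) p :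
    i \in mu f -> mu_pos mu (ts i) p -> mu_pos mu (Fun f ts) (val i :: p).

Definition mu_terms (F : signature) (mu : replacement_map F)
    (rel : relation (term F)) (s : term F) : Prop :=
  forall p u, subterm_at s p u -> ~ normal_form rel u -> mu_pos mu s p.

Definition usable_replacement_map (F : signature) (P : problem F)
    (R : trs F) (mu : replacement_map F) : Prop :=
  forall s, reachable P s -> mu_terms mu (qstep (query P) R) s.

Definition mu_monotone (F : signature) (mu : replacement_map F)
    (rel : relation (term F)) : Prop :=
  forall (f : F) (ts : {ffun 'I_(arity f) -> term F}) (i : 'I_(arity f)) s t,
    i \in mu f -> rel s t -> rel (Fun f (set_arg ts i s)) (Fun f (set_arg ts i t)).

Definition stable (F : signature) (rel : relation (term F)) : Prop :=
  forall (sigma : substitution F) s t,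
    rel s t -> rel (subst sigma s) (subst sigma t).

Record complexity_pair (F : signature) (ge gt : relation (term F)) : Prop :=
  ComplexityPair {
    cp_preorder : PreOrder ge;
    cp_order : StrictOrder gt;
    cp_ge_stable : stable ge;
    cp_gt_stable : stable gt;
    cp_compatible : forall s s' t' t, ge s s' -> gt s' t' -> ge t' t -> gt s t
  }.

Definition pair_monotone (F : signature) (P : problem F)
    (ge gt : relation (term F)) : Prop :=
  exists muW muS : replacement_map F,
    [/\ usable_replacement_map P (weak P) muW,
        usable_replacement_map P (strict P) muS,
        mu_monotone muW ge &
        mu_monotone muS gt].

Definition collapsible (F : signature) (P : problem F)
    (gt : relation (term F)) (G : term F -> nat) : Prop :=
  forall s t, reachable P s -> problem_rel P s t -> gt s t -> G t < G s.

(* "G(t) is in O(f(|t|)) for t in T" is taken in the worst-case sense in which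
   cc is defined: the function n |-> max { G(t) | t in T, |t| <= n } is in O(f).
   The termwise bound G(t) <= c * f(|t|) alone would not bound cc for a
   non-monotone f; see worst_case_bigOP below for when the two agree. *)
Definition induces (F : signature) (P : problem F) (gt : relation (term F))
    (f : nat -> nat) : Prop :=
  exists G : term F -> nat,
    collapsible P gt G /\ bigO (worst_case (start P) (fun t k => k = G t)) f.

Lemma is_max_exists (A : nat -> Prop) (b : nat) :
  (forall k, A k -> k <= b) -> exists m, is_max A m /\ m <= b.
Proof.
elim: b => [|b IHb] leAb.
  exists 0; split=> //; split=> //.
  have [A0|nA0] := classic (A 0); first by left.
  by right; split=> // k Ak; have := leAb k Ak; rewrite leqn0 => /eqP k0; subst k.
have [Ab|nAb] := classic (A b.+1); first by exists b.+1; split=> //; split=> //; left.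
have [|m [maxm lemb]] := IHb; last by exists m; split=> //; exact: leqW.
move=> k Ak; rewrite -ltnS ltn_neqAle leAb // andbT.
by apply/eqP => kb; subst k.
Qed.

Lemma worst_case_bigOP (F : signature) (T : term F -> Prop) (G : term F -> nat)
    (f : nat -> nat) :
  {homo f : m n / m <= n} -> (exists n, 0 < f n) ->
  bigO (worst_case T (fun t k => k = G t)) f <->
  (forall n, exists b, forall t, T t -> tsize t <= n -> G t <= b) /\
  (exists c N, forall t, T t -> N <= tsize t -> G t <= c * f (tsize t)).
Proof.
move=> fmono [n0 fn0]; split=> [[c [N cP]]|[bndG [c [N cP]]]].
  have le n t : N <= n -> T t -> tsize t <= n -> G t <= c * f n.
    move=> /cP[m [[_ [_ leGm]] lemc]] Tt ltn; apply: leq_trans lemc.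
    by apply: leGm; exists t.
  split; last by exists c, N => t Tt Nt; exact: le.
  move=> n; exists (c * f (maxn N n)) => t Tt ltn.
  by apply: le => //; rewrite ?leq_maxl // (leq_trans ltn) ?leq_maxr.
have [b bP] := bndG N; exists (c + b), (maxn N n0) => n.
rewrite geq_max => /andP[leNn /fmono len0n].
have fn1 : 0 < f n := leq_trans fn0 len0n.
have [|m [maxm lem]] := @is_max_exists
    (fun k => exists t, [/\ T t, tsize t <= n & k = G t]) ((c + b) * f n).
  move=> _ [t [Tt /fmono lftn ->]]; rewrite mulnDl.
  have [/(cP t Tt) leG|/ltnW/(bP t Tt) leG] := leqP N (tsize t).
    by apply: leq_trans leG (leq_trans _ (leq_addr _ _)); rewrite leq_mul2l lftn orbT.
  by apply: leq_trans leG (leq_trans _ (leq_addl _ _)); rewrite leq_pmulr.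
by exists m; split=> //; split=> // t _ _; exists (G t).
Qed.

(* Main.v *)
Require Import Defs.
From mathcomp Require Import all_boot.
From Stdlib Require Import Relations.

(** In a term reachable from the start terms, a redex of a rule of R is not a
normal form, so a usable replacement map for R contains its position. Hence
monotonicity at those positions and stability under substitutions suffice to
orient the whole step. By compatibility every relative step from a reachable
term is then contained in gt, so it decreases G, and derivations from a start
term t have length at most G t. *)

Set Implicit Arguments.
Unset Strict Implicit.
Unset Printing Implicit Defensive.

Lemma mu_pos_argE (F : signature) (mu : replacement_map F) (f : F)
    (ts : {ffun 'I_(arity f) -> term F}) (i : 'I_(arity f)) p :
  mu_pos mu (Fun f ts) (val i :: p) -> i \in mu f /\ mu_pos mu (ts i) p.
Proof.
(* The motive matches on the term because [inversion] would need decidable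
   equality on the symbols to project the dependent argument family. *)
move es: (Fun f ts) => s; move eq: (val i :: p) => q h.
suff: match s return Prop with
      | Var _ => True
      | Fun g us => forall (j : 'I_(arity g)) q',
          q = val j :: q' -> j \in mu g /\ mu_pos mu (us j) q'
      end by rewrite -es => /(_ i p (esym eq)).
case: h {es eq} => [[//|g us] j q' //|g us j q' jg hq k q'' [/val_inj <- <-]].
by split.
Qed.

(** The witness [p] is the position of the hole in [C]. If it lies in [mu_pos], every argument on
    the path to the hole is active, so monotonicity applies once per layer of [C]. *)
Lemma fill_mu_monotone (F : signature) (mu : replacement_map F)
    (rel : relation (term F)) (C : context F) (u v : term F) :
  mu_monotone mu rel -> rel u v ->
  exists p, subterm_at (fill C u) p u /\
    (mu_pos mu (fill C u) p -> rel (fill C u) (fill C v)).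
Proof.
move=> mono uv; elim: C => [|f ts i C [p [sub relC]]] /=.
  by exists [::]; split=> //; exact: subterm_at_root.
exists (val i :: p); split.
  by apply: subterm_at_arg; rewrite ffunE eqxx.
move=> /mu_pos_argE[imu]; rewrite ffunE eqxx => /relC; exact: mono.
Qed.

Lemma qstep_inclusion (F : signature) (mu : replacement_map F)
    (Q R rel : relation (term F)) (s t : term F) :
  mu_monotone mu rel -> stable rel -> inclusion _ R rel ->
  mu_terms mu (qstep Q R) s -> qstep Q R s t -> rel s t.
Proof.
move=> mono stab sub mus [C [sigma [f [ls [r [Rlr es -> nf]]]]]].
rewrite es in mus *; set u := Fun f _ in mus *.
have /(fill_mu_monotone C mono)[p [subp]] : rel u (subst sigma r).
  by apply: (stab sigma (Fun f ls)); exact: sub.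
(* The instance [u] of the left-hand side rewrites at its root, in the empty context, so it is not a
   normal form and [p] is active. *)
apply; apply: mus subp _ => nu; apply: nu.
by exists (subst sigma r), (Hole F), sigma, f, ls, r.
Qed.

Lemma qstepS (F : signature) (Q R R' : relation (term F)) :
  inclusion _ R R' -> inclusion _ (qstep Q R) (qstep Q R').
Proof.
move=> sub s t [C [sigma [f [ls [r [Rlr es et nf]]]]]].
by exists C, sigma, f, ls, r; split=> //; exact: sub.
Qed.

Lemma reachable_step (F : signature) (P : problem F) (s t : term F) :
  reachable P s -> problem_step P s t -> reachable P t.
Proof.
move=> [u [Tu us]] st; exists u; split=> //.
by apply: rt_trans us _; exact: rt_step.
Qed.

Lemma reachable_strict (F : signature) (P : problem F) (s t : term F) :
  reachable P s -> qstep (query P) (strict P) s t -> reachable P t.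
Proof.
move=> rs st; apply: reachable_step rs _.
by apply: qstepS st => l r; left.
Qed.

Lemma reachable_weak (F : signature) (P : problem F) (s t : term F) :
  reachable P s -> qstep (query P) (weak P) s t -> reachable P t.
Proof.
move=> rs st; apply: reachable_step rs _.
by apply: qstepS st => l r; right.
Qed.

Section Orientation.

Variables (F : signature) (P : problem F) (ge gt : relation (term F)).
Hypotheses (hpair : complexity_pair ge gt) (hmono : pair_monotone P ge gt).
Hypotheses (hS : inclusion _ (strict P) gt) (hW : inclusion _ (weak P) ge).

(** Reachability is carried along the weak steps because a usable replacement map only constrains
    reachable terms. *)
Lemma weak_steps_ge (s t : term F) :
  reachable P s -> clos_refl_trans _ (qstep (query P) (weak P)) s t ->
  ge s t /\ reachable P t.
Proof.
have [muW [_ [useW _ monoW _]]] := hmono.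
have [ge_refl ge_trans] := cp_preorder hpair.
move=> + st; elim: st => {s t} [s t st rs|s rs|s t u _ IHst _ IHtu rs].
- split; last exact: reachable_weak st.
  exact: (qstep_inclusion monoW (cp_ge_stable hpair) hW (useW s rs) st).
- by [].
- have [gst rt] := IHst rs; have [gtu ru] := IHtu rt.
  by split=> //; exact: ge_trans gtu.
Qed.

Lemma problem_rel_gt (s t : term F) :
  reachable P s -> problem_rel P s t -> gt s t /\ reachable P t.
Proof.
have [_ [muS [_ useS _ monoS]]] := hmono.
move=> rs [s' [t' [ss' st' tt']]].
have [ge_s rs'] := weak_steps_ge rs ss'.
have [ge_t rt] := weak_steps_ge (reachable_strict rs' st') tt'.
split=> //; apply: (cp_compatible hpair ge_s _ ge_t).
exact: (qstep_inclusion monoS (cp_gt_stable hpair) hS (useS s' rs') st').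
Qed.

Lemma derivation_collapsible (G : term F -> nat) (t : term F) (n : nat) :
  collapsible P gt G -> reachable P t -> derivation (problem_rel P) t n ->
  n <= G t.
Proof.
move=> coll rt [u [u0 stepu]].
(* Each step lowers [G] by at least one, so the number of steps made plus the current value of [G]
   never exceeds [G t]. *)
suff /(_ n (leqnn n))[_] : forall k, k <= n ->
    reachable P (u k) /\ k + G (u k) <= G t.
  by apply: leq_trans; exact: leq_addr.
elim=> [_|k IHk ltkn]; first by rewrite u0.
have [ruk leG] := IHk (ltnW ltkn).
have [gtk ruk1] := problem_rel_gt ruk (stepu k ltkn).
split=> //; apply: leq_trans leG; rewrite addSnnS leq_add2l.
exact: coll (stepu k ltkn) gtk.
Qed.

End Orientation.

(** One uniform bound yields both maxima: the derivation height of each term, and the largest such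
    height among the terms of size at most [n]. *)
Lemma worst_case_dh_exists (F : signature) (rel : relation (term F))
    (T : term F -> Prop) (n b : nat) :
  (forall t k, T t -> Defs.tsize t <= n -> derivation rel t k -> k <= b) ->
  exists m, worst_case T (dh rel) n m /\ m <= b.
Proof.
move=> bnd.
have [|m [maxm lemb]] := @is_max_exists
    (fun k => exists t, [/\ T t, Defs.tsize t <= n & dh rel t k]) b.
  move=> k [t [Tt ltn [[der|[-> _]] _]]] //; exact: bnd der.
exists m; split=> //; split=> // t Tt ltn.
have [|k [maxk _]] := @is_max_exists (derivation rel t) b; last by exists k.
by move=> k; exact: bnd.
Qed.

Theorem mainTheorem3 (F : signature) (P : problem F) (f : nat -> nat)
    (ge gt : relation (term F))
    (hpair : complexity_pair ge gt)
    (hmono : pair_monotone P ge gt)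
    (hind : induces P gt f)
    (hS : inclusion _ (strict P) gt)
    (hW : inclusion _ (weak P) ge) :
  valid_judgement P f.
Proof.
have [G [coll [c [N GP]]]] := hind.
have bnd n t k : N <= n -> start P t -> Defs.tsize t <= n ->
    derivation (problem_rel P) t k -> k <= c * f n.
  move=> /GP[m [[_ [_ leGm]] lemc]] Tt ltn der.
  have rt : reachable P t by exists t; split=> //; exact: rt_refl.
  apply: leq_trans (derivation_collapsible hpair hmono hS hW coll rt der) _.
  by apply: leq_trans lemc; apply: leGm; exists t.
split=> [n|].
  (* For [n] below [N], the bound is taken at size [N], since terms of size at most [n] also have
     size at most [maxn N n]. *)
  have [|m [ccm _]] := @worst_case_dh_exists F (problem_rel P) (start P) n
      (c * f (maxn N n)); last by exists m.
  move=> t k Tt ltn; apply: bnd => //; first exact: leq_maxl.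
  exact: leq_trans (leq_maxr _ _).
exists c, N => n leNn; apply: worst_case_dh_exists => t k; exact: bnd.
Qed.
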